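(* Let $\Bbbk$ be a field and $n\ge 1$. For $s,t\in\Bbbk$ and $M_1,M_2\in M_n(\Bbbk)$ define a binary operation on $M_n(\Bbbk)$ by $$A *_{s,t,M_1,M_2} B = s\,A M_1 B + t\,A M_2 B.$$ Then the algebraic system $(M_n(\Bbbk), *_{s,t,M_1,M_2},\ s,t\in\Bbbk,\ M_1,M_2\in M_n(\Bbbk))$ is a semigroup system.
   Context: $M_n(\Bbbk)$ is the set of $n\times n$ matrices over $\Bbbk$. A semigroup system is a set $G$ with a family of binary operations $(G,*_i,i\in I)$ such that $(G,*_i)$ is a semigroup for every $i\in I$. *)

(* Defs.v *)
From mathcomp Require Import all_boot all_order all_algebra.

Set Implicit Arguments.
Unset Strict Implicit.
Unset Printing Implicit Defensive.

Import GRing.Theory.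
Local Open Scope ring_scope.

(* No compatibility between the different operations is required. *)
Definition semigroup_system (G I : Type) (op : I -> G -> G -> G) : Prop :=
  forall i : I, associative (op i).

Definition star (K : fieldType) (n : nat) (s t : K) (M1 M2 A B : 'M[K]_n) :
    'M[K]_n :=
  s *: (A *m M1 *m B) + t *: (A *m M2 *m B).

(* The index set consists of all quadruples (s, t, M1, M2). *)
Definition star_family (K : fieldType) (n : nat)
    (i : K * K * 'M[K]_n * 'M[K]_n) : 'M[K]_n -> 'M[K]_n -> 'M[K]_n :=
  let: (s, t, M1, M2) := i in star s t M1 M2.

(* Main.v *)
Require Import Defs.
From mathcomp Require Import all_boot all_order all_algebra.

(** By bilinearity of the matrix product, the operation with parameters
    (s, t, M1, M2) is the sandwich product A M B with the single matrix
    M = s M1 + t M2 in the middle ([star_sandwich]).  A sandwich product is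
    associative because the matrix product is: both bracketings of A, B, C
    equal A M B M C. *)

Import GRing.Theory.
Local Open Scope ring_scope.

Lemma star_sandwich (K : fieldType) (n : nat) (s t : K)
    (M1 M2 A B : 'M[K]_n) :
  star s t M1 M2 A B = A *m (s *: M1 + t *: M2) *m B.
Proof. by rewrite /star mulmxDr mulmxDl -!scalemxAr -!scalemxAl. Qed.

Theorem corollary3p3 (K : fieldType) (n : nat) (hn : (1 <= n)%N) :
  semigroup_system (@star_family K n).
Proof.
move=> [[[s t] M1] M2] A B C /=.
by rewrite !star_sandwich !mulmxA.
Qed.
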